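(* Let $X\subset\mathbb{R}^n$ be nonempty and open, let $f_j\colon X\to\mathbb{R}$ ($j\in J:=\{1,\dots,p\}$) and $g_i\colon X\to\mathbb{R}$ ($i\in I:=\{1,\dots,m\}$) be continuously differentiable, and let $\mathcal{F}:=\{x\in X: g_i(x)\le 0,\ i\in I\}$. Consider the vector optimization problem (VP) of minimizing $f=(f_1,\dots,f_p)$ over $\mathcal{F}$ with respect to the componentwise order. Let $\bar x\in\mathcal{F}$. Suppose that $f_j$, $j\in J$, and $g_i$, $i\in I(\bar x)$, are second-order directionally differentiable at $\bar x$ in every critical direction $d\in\mathcal{C}(\bar x)$, that $f_j$, $j\in J$, are $2$-pseudoconvex at $\bar x$, and that $g_i$, $i\in I(\bar x)$, are quasiconvex at $\bar x$. If for each $d\in\mathcal{C}(\bar x)$ there exist $\mu\in\mathbb{R}^p_+\setminus\{0\}$ and $\lambda\in\mathbb{R}^m_+$ such that $$\sum_{j=1}^p\mu_j\nabla f_j(\bar x)+\sum_{i=1}^m\lambda_i\nabla g_i(\bar x)=0,$$ $$\sum_{j=1}^p\mu_j f_j''(\bar x;d)+\sum_{i=1}^m\lambda_i g_i''(\bar x;d)\ge0,$$ $$\lambda_i g_i(\bar x)=0\quad\text{for all } i\in I,$$ then $\bar x$ is a global weak efficient solution of (VP).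
   Context: $\langle\cdot,\cdot\rangle$ is the Euclidean scalar product; $\mathbb{R}^p_+$ is the nonnegative orthant. Second-order directional derivative (Demyanov--Pevnyi): for $\phi\colon X\to\mathbb{R}$ differentiable at $x\in X$ and $d\in\mathbb{R}^n$, $$\phi''(x;d):=\lim_{t\downarrow0}\frac{2}{t^2}\big[\phi(x+td)-\phi(x)-t\langle\nabla\phi(x),d\rangle\big];$$ $\phi$ is second-order directionally differentiable at $x$ in the direction $d$ if this limit exists and is finite. $I(\bar x):=\{i\in I: g_i(\bar x)=0\}$. The set of critical directions at $\bar x$ is $\mathcal{C}(\bar x):=\{d\in\mathbb{R}^n:\langle\nabla f_j(\bar x),d\rangle\le0\ \forall j\in J,\ \langle\nabla g_i(\bar x),d\rangle\le0\ \forall i\in I(\bar x)\}$. Quasiconvexity: $\phi\colon X\to\mathbb{R}$ is quasiconvex at $\bar x$ if $y\in X$, $\phi(y)\le\phi(\bar x)$, $t\in[0,1]$, $(1-t)\bar x+ty\in X$ imply $\phi(\bar x+t(y-\bar x))\le\phi(\bar x)$. $2$-pseudoconvexity: let $\phi\colon X\to\mathbb{R}$ be differentiable at $\bar x$ and second-order directionally differentiable at $\bar x$ in every direction $y-\bar x$ with $y\in X$, $\phi(y)<\phi(\bar x)$, $\langle\nabla\phi(\bar x),y-\bar x\rangle=0$. Then $\phi$ is $2$-pseudoconvex at $\bar x$ if for all $y\in X$: (i) $\phi(y)<\phi(\bar x)$ implies $\langle\nabla\phi(\bar x),y-\bar x\rangle\le0$; (ii) $\phi(y)<\phi(\bar x)$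 and $\langle\nabla\phi(\bar x),y-\bar x\rangle=0$ imply $\phi''(\bar x;y-\bar x)<0$. Global weak efficient solution: $\bar x\in\mathcal{F}$ such that there is no $x\in\mathcal{F}$ with $f_j(x)<f_j(\bar x)$ for all $j\in J$. Convention: a term $\lambda_i g_i''(\bar x;d)$ with $\lambda_i=0$ (in particular with $i\notin I(\bar x)$) is taken to be $0$. *)

(* Defs.v *)
From HB Require Import structures.
From mathcomp Require Import all_boot all_order all_algebra.
From mathcomp Require Import all_classical all_reals all_analysis.
Import Order.TTheory GRing.Theory Num.Theory.
Import numFieldNormedType.Exports.

Set Implicit Arguments.
Unset Strict Implicit.
Unset Printing Implicit Defensive.

Local Open Scope classical_set_scope.
Local Open Scope ring_scope.

(* A function on a subset X of R^n is represented by a total function on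
   'rV[R]_n. As X is open in the theorem and every notion below involves only
   values on X, or near a point of X, the values outside X are irrelevant.
   The library norm on 'rV[R]_n is the sup norm, which defines the same open
   sets, derivatives and continuous maps as the Euclidean norm. *)

Definition dot (R : realType) (n : nat) (u v : 'rV[R]_n) : R :=
  \sum_(i < n) u 0 i * v 0 i.

Definition gradient (R : realType) (n : nat) (phi : 'rV[R]_n -> R)
    (x : 'rV[R]_n) : 'rV[R]_n :=
  \row_(i < n) 'D_(delta_mx 0 i) phi x.

Definition continuously_differentiable (R : realType) (n : nat)
    (X : set 'rV[R]_n) (phi : 'rV[R]_n -> R) : Prop :=
  (forall x, X x -> differentiable phi x) /\
  {within X, continuous (gradient phi)}.

Definition second_order_quotient (R : realType) (n : nat)
    (phi : 'rV[R]_n -> R) (x d : 'rV[R]_n) (t : R) : R :=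
  2 / t ^+ 2 * (phi (x + t *: d) - phi x - t * dot (gradient phi x) d).

(* Since the quotient is R-valued, cvg means that the limit is finite. *)
Definition second_order_directionally_differentiable (R : realType) (n : nat)
    (phi : 'rV[R]_n -> R) (x d : 'rV[R]_n) : Prop :=
  differentiable phi x /\
  cvg (second_order_quotient phi x d t @[t --> 0^'+]).

(* lim is total, with an arbitrary real value when the limit does not exist;
   hence 0 * dderive2 phi x d = 0 in all cases. *)
Definition dderive2 (R : realType) (n : nat)
    (phi : 'rV[R]_n -> R) (x d : 'rV[R]_n) : R :=
  lim (second_order_quotient phi x d t @[t --> 0^'+]).

Definition quasiconvex_at (R : realType) (n : nat)
    (X : set 'rV[R]_n) (phi : 'rV[R]_n -> R) (xb : 'rV[R]_n) : Prop :=
  forall (y : 'rV[R]_n) (t : R),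
    X y -> phi y <= phi xb -> 0 <= t <= 1 -> X ((1 - t) *: xb + t *: y) ->
    phi (xb + t *: (y - xb)) <= phi xb.

Definition two_pseudoconvex_at (R : realType) (n : nat)
    (X : set 'rV[R]_n) (phi : 'rV[R]_n -> R) (xb : 'rV[R]_n) : Prop :=
  [/\ differentiable phi xb,
      forall y, X y -> phi y < phi xb ->
        dot (gradient phi xb) (y - xb) = 0 ->
        second_order_directionally_differentiable phi xb (y - xb),
      forall y, X y -> phi y < phi xb ->
        dot (gradient phi xb) (y - xb) <= 0 &
      forall y, X y -> phi y < phi xb ->
        dot (gradient phi xb) (y - xb) = 0 ->
        dderive2 phi xb (y - xb) < 0].

Definition feasible_set (R : realType) (n m : nat) (X : set 'rV[R]_n)
    (g : 'I_m -> 'rV[R]_n -> R) : set 'rV[R]_n :=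
  [set x | X x /\ forall i, g i x <= 0].

Definition active_set (R : realType) (n m : nat)
    (g : 'I_m -> 'rV[R]_n -> R) (xb : 'rV[R]_n) : set 'I_m :=
  [set i | g i xb = 0].

Definition critical_directions (R : realType) (n p m : nat)
    (f : 'I_p -> 'rV[R]_n -> R) (g : 'I_m -> 'rV[R]_n -> R)
    (xb : 'rV[R]_n) : set 'rV[R]_n :=
  [set d | (forall j, dot (gradient (f j) xb) d <= 0) /\
           (forall i, active_set g xb i -> dot (gradient (g i) xb) d <= 0)].

Definition global_weak_efficient_solution (R : realType) (n p m : nat)
    (X : set 'rV[R]_n) (f : 'I_p -> 'rV[R]_n -> R)
    (g : 'I_m -> 'rV[R]_n -> R) (xb : 'rV[R]_n) : Prop :=
  feasible_set X g xb /\
  ~ (exists2 x, feasible_set X g x & forall j, f j x < f j xb).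

(* Main.v *)
(** Suppose a feasible [x] improves every objective, and let [d = x - xb].
    Pseudoconvexity of the objectives and quasiconvexity of the active
    constraints make [d] critical. Pairing the first-order KKT equation with
    [d] gives a vanishing sum of nonpositive terms, so every gradient carrying
    a nonzero multiplier is orthogonal to [d]. The corresponding second
    derivatives are then negative for the objectives and nonpositive for the
    constraints, and as [mu] is nonzero this contradicts the second-order
    inequality. *)
Require Import Defs.
From mathcomp Require Import all_boot all_order all_algebra.
From mathcomp Require Import all_classical all_reals all_analysis.

Set Implicit Arguments.
Unset Strict Implicit.
Unset Printing Implicit Defensive.

Import Order.TTheory GRing.Theory Num.Theory.
Import numFieldNormedType.Exports.

Local Open Scope classical_set_scope.
Local Open Scope ring_scope.

Lemma dotDl (R : realType) (n : nat) (u v w : 'rV[R]_n) :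
  dot (u + v) w = dot u w + dot v w.
Proof.
by rewrite /dot -big_split; apply: eq_bigr => i _; rewrite !mxE mulrDl.
Qed.

Lemma dot_suml (R : realType) (n k : nat) (c : 'rV[R]_k)
    (u : 'I_k -> 'rV[R]_n) (w : 'rV[R]_n) :
  dot (\sum_(j < k) c 0 j *: u j) w = \sum_(j < k) c 0 j * dot (u j) w.
Proof.
rewrite /dot; under eq_bigr do rewrite summxE mulr_suml.
rewrite exchange_big; apply: eq_bigr => j _.
by rewrite mulr_sumr; apply: eq_bigr => i _; rewrite !mxE mulrA.
Qed.

(** The differential is linear, so it can be evaluated on the expansion of [d] in the standard
    basis. *)
Lemma dot_gradient (R : realType) (n : nat) (phi : 'rV[R]_n -> R)
    (x d : 'rV[R]_n) :
  differentiable phi x -> dot (gradient phi x) d = 'D_d phi x.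
Proof.
move=> dphi; rewrite deriveE// [in RHS](row_sum_delta d) linear_sum.
by apply: eq_bigr => i _; rewrite linearZ !mxE deriveE// mulrC.
Qed.

(** The pairing is a directional derivative, hence also the limit from the right of difference
    quotients that are nonpositive for small [t > 0]. *)
Lemma dot_gradient_le0 (R : realType) (n : nat) (phi : 'rV[R]_n -> R)
    (x d : 'rV[R]_n) :
  differentiable phi x ->
  (\forall t \near 0^'+, phi (x + t *: d) <= phi x) ->
  dot (gradient phi x) d <= 0.
Proof.
move=> dphi phi_le; rewrite dot_gradient//.
have : derivable phi x d by exact: diff_derivable.
move=> /cvg_ex[l lP]; have -> : 'D_d phi x = l by exact/cvg_lim.
have {}lP : t^-1 *: (phi (t *: d + x) - phi x) @[t --> 0^'+] --> l.
  exact: cvg_dnbhs_at_right.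
apply: (cvgr_to_le lP); near=> t.
rewrite pmulr_rle0 ?invr_gt0// subr_le0 addrC.
by near: t.
Unshelve. all: by end_near. Qed.

(** Once the first-order term vanishes, the second-order quotient has the sign of
    [phi (x + t *: d) - phi x]. *)
Lemma dderive2_le0 (R : realType) (n : nat) (phi : 'rV[R]_n -> R)
    (x d : 'rV[R]_n) :
  second_order_directionally_differentiable phi x d ->
  dot (gradient phi x) d = 0 ->
  (\forall t \near 0^'+, phi (x + t *: d) <= phi x) ->
  dderive2 phi x d <= 0.
Proof.
move=> [_ cvq] grad0 phi_le; apply: limr_le => //; near=> t.
rewrite /second_order_quotient grad0 mulr0 subr0.
rewrite pmulr_rle0 ?divr_gt0 ?exprn_gt0// subr_le0.
by near: t.
Unshelve. all: by end_near. Qed.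

(** The segment from [x] to [y] may leave [X], but openness keeps its points with small [t] inside,
    and there quasiconvexity applies. *)
Lemma quasiconvex_at_near_le (R : realType) (n : nat) (X : set 'rV[R]_n)
    (phi : 'rV[R]_n -> R) (x y : 'rV[R]_n) :
  open X -> X x -> X y -> quasiconvex_at X phi x -> phi y <= phi x ->
  \forall t \near 0^'+, phi (x + t *: (y - x)) <= phi x.
Proof.
move=> oX Xx Xy qphi phi_le.
have cvgx : (1 - t) *: x + t *: y @[t --> (0 : R)] --> (1 - 0) *: x + 0 *: y.
  by apply: cvgD; apply: cvgZr_tmp => //; apply: cvgB => //; exact: cvg_cst.
rewrite subr0 scale1r scale0r addr0 in cvgx.
have XN : \forall t \near 0^'+, X ((1 - t) *: x + t *: y).
  by apply: (cvg_at_right_filter cvgx); exact: open_nbhs_nbhs.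
near=> t; apply: qphi => //.
  by apply/andP; split => //; near: t; exact: nbhs_right_le.
by near: t.
Unshelve. all: by end_near. Qed.

Lemma nsumr_eq0P (R : numDomainType) (I : finType) (F : I -> R) :
  (forall i, F i <= 0) -> \sum_i F i = 0 -> forall i, F i = 0.
Proof.
move=> F_le0 sumF0 i; apply: oppr_inj; rewrite oppr0.
apply: (@psumr_eq0P _ _ xpredT (fun i => - F i)) => // [j _|].
  by rewrite oppr_ge0.
by rewrite sumrN sumF0 oppr0.
Qed.

Lemma nsumrD_eq0P (R : numDomainType) (I J : finType)
    (a : I -> R) (b : J -> R) :
  (forall i, a i <= 0) -> (forall j, b j <= 0) ->
  \sum_i a i + \sum_j b j = 0 ->
  (forall i, a i = 0) /\ (forall j, b j = 0).
Proof.
move=> a_le0 b_le0 /eqP; rewrite naddr_eq0 ?sumr_le0// => /andP[/eqP a0 /eqP b0].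
by split; exact: nsumr_eq0P.
Qed.

Theorem theorem3p1 (R : realType) (n p m : nat) (X : set 'rV[R]_n)
    (f : 'I_p -> 'rV[R]_n -> R) (g : 'I_m -> 'rV[R]_n -> R) (xb : 'rV[R]_n)
    (X_nonempty : X !=set0) (X_open : open X)
    (f_C1 : forall j, continuously_differentiable X (f j))
    (g_C1 : forall i, continuously_differentiable X (g i))
    (xb_feasible : feasible_set X g xb)
    (f_sodd : forall j d, critical_directions f g xb d ->
      second_order_directionally_differentiable (f j) xb d)
    (g_sodd : forall i d, active_set g xb i -> critical_directions f g xb d ->
      second_order_directionally_differentiable (g i) xb d)
    (f_2pseudoconvex : forall j, two_pseudoconvex_at X (f j) xb)
    (g_quasiconvex : forall i, active_set g xb i ->
      quasiconvex_at X (g i) xb)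
    (second_order_KKT : forall d, critical_directions f g xb d ->
      exists (mu : 'rV[R]_p) (lambda : 'rV[R]_m),
        [/\ (forall j, 0 <= mu 0 j) /\ mu != 0,
            forall i, 0 <= lambda 0 i,
            \sum_(j < p) mu 0 j *: gradient (f j) xb +
              \sum_(i < m) lambda 0 i *: gradient (g i) xb = 0,
            0 <= \sum_(j < p) mu 0 j * dderive2 (f j) xb d +
              \sum_(i < m) lambda 0 i * dderive2 (g i) xb d &
            forall i, lambda 0 i * g i xb = 0]) :
  global_weak_efficient_solution X f g xb.
Proof.
split=> // -[x [Xx gx] fx]; have [Xxb _] := xb_feasible.
pose d := x - xb.
have g_near i : active_set g xb i ->
    \forall t \near 0^'+, g i (xb + t *: d) <= g i xb.
  (* For an active constraint [g i xb = 0], so feasibility of [x] reads [g i x <= g i xb]. *)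
  move=> gi0; apply: quasiconvex_at_near_le (g_quasiconvex i gi0) _ => //.
  by rewrite gi0.
have df j : dot (gradient (f j) xb) d <= 0.
  by have [_ _ + _] := f_2pseudoconvex j; exact.
have dg i : active_set g xb i -> dot (gradient (g i) xb) d <= 0.
  move=> gi0; apply: dot_gradient_le0 (g_near i gi0).
  by have [+ _] := g_C1 i; exact.
have [mu [lambda [[mu_ge0 mu_neq0] lambda_ge0 KKT1 KKT2 compl]]] :=
  second_order_KKT d (conj df dg).
have lambda_active i : lambda 0 i != 0 -> active_set g xb i.
  by move=> l0; apply/eqP; have /eqP := compl i; rewrite mulf_eq0 (negPf l0).
have [mu_df lambda_dg] :
    (forall j, mu 0 j * dot (gradient (f j) xb) d = 0) /\
    (forall i, lambda 0 i * dot (gradient (g i) xb) d = 0).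
  (* The terms are nonpositive, and their sum is the pairing of the vanishing KKT combination with
     [d]. *)
  apply: nsumrD_eq0P => [j|i|].
  - exact: mulr_ge0_le0.
  (* An inactive constraint has no sign condition along [d], but complementarity makes its
     multiplier zero. *)
  - have [->|l0] := eqVneq (lambda 0 i) 0; first by rewrite mul0r.
    by apply: mulr_ge0_le0 => //; exact/dg/lambda_active.
  - rewrite -!dot_suml -dotDl KKT1.
    by rewrite /dot big1// => i _; rewrite mxE mul0r.
have f2 j : mu 0 j != 0 -> mu 0 j * dderive2 (f j) xb d < 0.
  move=> mj0; have [_ _ _ f2j] := f_2pseudoconvex j.
  rewrite pmulr_rlt0; last by rewrite lt0r mj0 mu_ge0.
  apply: f2j => //; apply/eqP.
  by have /eqP := mu_df j; rewrite mulf_eq0 (negPf mj0).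
have g2 i : lambda 0 i * dderive2 (g i) xb d <= 0.
  (* With a zero multiplier the product is zero even if [dderive2] is only the default value of a
     nonexistent limit. *)
  have [->|l0] := eqVneq (lambda 0 i) 0; first by rewrite mul0r.
  have gi0 := lambda_active i l0.
  apply: mulr_ge0_le0 => //.
  apply: dderive2_le0 (g_sodd i d gi0 (conj df dg)) _ (g_near i gi0).
  by apply/eqP; have /eqP := lambda_dg i; rewrite mulf_eq0 (negPf l0).
have f2_le0 j : mu 0 j * dderive2 (f j) xb d <= 0.
  by have [->|/f2/ltW//] := eqVneq (mu 0 j) 0; rewrite mul0r.
have /rV0Pn[j0 mj0] := mu_neq0.
have [f2_eq0 _] : (forall j, mu 0 j * dderive2 (f j) xb d = 0) /\
    (forall i, lambda 0 i * dderive2 (g i) xb d = 0).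
  (* [KKT2] bounds the total below by zero and the signs bound it above, so every term vanishes,
     against strict negativity at [j0]. *)
  apply: nsumrD_eq0P => //; apply/le_anti.
  by rewrite KKT2 andbT -[leRHS]addr0 lerD// sumr_le0.
by have := f2 j0 mj0; rewrite f2_eq0 ltxx.
Qed.
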